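(* There is an inner algorithm for three-dimensional \textsc{Tarski} that makes $O(\log n)$ queries, where $n$ is the width of the lattice.
   Context: For positive integers $n_1,\dots,n_k$, the lattice $L = L(n_1,\dots,n_k)$ is the set of all $x \in \mathbb{N}^k$ with $1 \le x_i \le n_i$, ordered by $x \preceq y$ iff $x_i \le y_i$ for all $i$; its width is $n=\max_i n_i$. Here $k=3$ and $f : L \to L$ is accessed by queries (evaluations of $f$). Define $\mathrm{Up}(f) = \{x \in L : x \preceq f(x)\}$ and $\mathrm{Down}(f) = \{x \in L : f(x) \preceq x\}$. For $x \preceq y$, the sub-instance $L_{x,y} = \{a \in L : x \preceq a \preceq y\}$. A slice is a tuple $s = (s_1,\dots,s_k)$ with each $s_i \in \mathbb{N} \cup \{*\}$, and $L_s = \{x \in L : x_i = s_i \text{ whenever } s_i \ne *\}$; a principal slice fixes exactly one coordinate (exactly one $s_i \neq *$). Two points $x,y$ witness a violation of order preservation of $f$ if $x \preceq y$ and $f(x) \not\preceq f(y)$. An inner algorithm is an algorithm that takes as input a sub-instance $L_{a,b}$ with $a \preceq b$, $a \in \mathrm{Up}(f)$ and $b \in \mathrm{Down}(f)$, and a principal slice $s$ of that sub-instance, and outputs either a point $x \in L_{a,b} \cap L_s$ such that $x \in \mathrm{Up}(f)$ or $x \in \mathrm{Down}(f)$, or two points $x, y \in L_{a,b}$ that witness a violation of order preservation of $f$. *)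

(* Defs.v *)
From mathcomp Require Import all_boot.

Set Implicit Arguments.
Unset Strict Implicit.
Unset Printing Implicit Defensive.

Definition lattice (k : nat) (n : 'I_k -> nat) : Type :=
  {x : {ffun 'I_k -> nat} | [forall i, 0 < x i <= n i]}.

Definition width (k : nat) (n : 'I_k -> nat) : nat := \max_(i < k) n i.

Section Lattice.
Variables (k : nat) (n : 'I_k -> nat).
Implicit Types (x y a b : lattice n) (f : lattice n -> lattice n).

Definition coord x (i : 'I_k) : nat := val x i.

Definition preceq x y : bool := [forall i, coord x i <= coord y i].

Definition Up f x : bool := preceq x (f x).
Definition Down f x : bool := preceq (f x) x.

Definition sub_instance a b x : bool := preceq a x && preceq x b.

Definition violation f x y : bool := preceq x y && ~~ preceq (f x) (f y).

End Lattice.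

(* [None] stands for the free-coordinate symbol "*". *)
Definition slice (k : nat) : Type := 'I_k -> option nat.

Definition in_slice (k : nat) (n : 'I_k -> nat) (s : slice k)
    (x : lattice n) : Prop :=
  forall (i : 'I_k) (c : nat), s i = Some c -> coord x i = c.

Definition principal (k : nat) (s : slice k) : Prop :=
  exists! i : 'I_k, s i <> None.

(* Deterministic adaptive query algorithms, as decision trees: [Query q next]
   evaluates the unknown function at [q] and continues according to the
   answer. *)
Inductive query_tree (Q A O : Type) : Type :=
| Output of O
| Query of Q & (A -> query_tree Q A O).

Fixpoint run (Q A O : Type) (f : Q -> A) (t : query_tree Q A O) : O :=
  match t with
  | Output o => o
  | Query q next => run f (next (f q))
  end.

Fixpoint num_queries (Q A O : Type) (f : Q -> A) (t : query_tree Q A O)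
    : nat :=
  match t with
  | Output _ => 0
  | Query q next => (num_queries f (next (f q))).+1
  end.

Inductive inner_output (k : nat) (n : 'I_k -> nat) : Type :=
| Point of lattice n
| Pair of lattice n & lattice n.

(* The algorithm is given n_1, ..., n_k, the two corners of the sub-instance
   and the slice; it accesses f only through the queries of its tree. *)
Definition slice_algorithm (k : nat) : Type :=
  forall (n : 'I_k -> nat) (a b : lattice n) (s : slice k),
    query_tree (lattice n) (lattice n) (inner_output n).

(* The last conjunct says that [s] is a slice of the sub-instance itself, i.e.
   that its fixed coordinate lies within the bounds given by [a] and [b]. *)
Definition inner_input (k : nat) (n : 'I_k -> nat)
    (f : lattice n -> lattice n) (a b : lattice n) (s : slice k) : Prop :=
  [/\ forall i, 0 < n i,
      preceq a b,
      Up f a /\ Down f b,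
      principal s &
      forall i c, s i = Some c -> coord a i <= c <= coord b i].

Definition correct_output (k : nat) (n : 'I_k -> nat)
    (f : lattice n -> lattice n) (a b : lattice n) (s : slice k)
    (o : inner_output n) : Prop :=
  match o with
  | Point x => [/\ sub_instance a b x, in_slice s x & Up f x \/ Down f x]
  | Pair x y => [/\ sub_instance a b x, sub_instance a b y & violation f x y]
  end.

Definition inner_algorithm (k : nat) (alg : slice_algorithm k) : Prop :=
  forall (n : 'I_k -> nat) (f : lattice n -> lattice n) (a b : lattice n)
    (s : slice k),
    inner_input f a b s -> correct_output f a b s (run f (alg n a b s)).

(* Main.v *)
Require Import Defs.
From mathcomp Require Import all_boot zify.

Set Implicit Arguments.
Unset Strict Implicit.
Unset Printing Implicit Defensive.

(** Write [s1], [s2], [s3] for the signs of [f(x) - x] in the two free coordinates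
    and in the coordinate fixed by the slice. The algorithm shrinks a rectangle
    [[l, u]] of the slice. Its lower corner need not satisfy [s1, s2 >= 0]; it is
    enough that [s2(l) >= 0] and that some queried point [e] of the left edge has
    [s1(e) >= 0 >= s3(e)], or the same with the two free coordinates exchanged.
    The upper corner satisfies the dual condition.

    Any queried point [m] then gives cuts that keep these conditions, unless one
    of the queried points is a solution: if [s3(m) <= 0], then [s1(m) >= 0] allows
    [l1 := m1] and [s2(m) >= 0] allows [l2 := m2]; dually if [s3(m) >= 0]. When [m]
    is not a solution, one of these applies. So constantly many queries on the
    3x3 grid spanned by the corners and the middle of the rectangle halve one of
    its sides, and a rectangle with both sides at most 1 has a solution among its
    corners. The argument uses monotonicity only between queried points, so if
    it fails then two queried points witness a violation. *)

(** * The planar problem on the slice and the box invariant *)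

(* The slice as seen by the algorithm: [dom] is the set of queried points, the
   first two functions are the free coordinates of [f], the third is its
   coordinate fixed by the slice, and [level] is the value the slice fixes. *)
Record planar := Planar {
  dom : nat -> nat -> Prop;
  fst_of : nat -> nat -> nat;
  snd_of : nat -> nat -> nat;
  trd_of : nat -> nat -> nat;
  level : nat }.

Definition transpose (O : planar) : planar :=
  Planar (fun x y => dom O y x) (fun x y => snd_of O y x)
    (fun x y => fst_of O y x) (fun x y => trd_of O y x) (level O).

(* The cuts are proved for an abstract total order so that order reversal turns
   statements on lower corners into statements on upper corners. *)
Definition flip_rel (le : rel nat) : rel nat := fun x y => le y x.

Definition monotone_on (le : rel nat) (D : nat -> nat -> Prop)
    (F : nat -> nat -> nat) : Prop :=
  forall x y x' y', D x y -> D x' y' -> le x x' -> le y y' ->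
    le (F x y) (F x' y').

Definition up_at (le : rel nat) (O : planar) x y : bool :=
  [&& le x (fst_of O x y), le y (snd_of O x y) & le (level O) (trd_of O x y)].

(** The state in which the search would fail: the queried points show neither a violation nor a
    solution. The planar part of the proof refutes it. *)
Definition unsolved (le : rel nat) (O : planar) : Prop :=
  [/\ monotone_on le (dom O) (fst_of O), monotone_on le (dom O) (snd_of O),
      monotone_on le (dom O) (trd_of O),
      forall x y, dom O x y -> ~~ up_at le O x y &
      forall x y, dom O x y -> ~~ up_at (flip_rel le) O x y].

(* Stands in for a lower corner that is known to lie on the left edge, but not
   where: unless [l] itself is such a corner, the first coordinate of [f - id]
   changes sign between [l2] and [e], next to a corner or a solution. *)
Definition left_witness (le : rel nat) (O : planar) (l1 l2 u2 : nat) : Prop :=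
  le l2 (snd_of O l1 l2) /\
  exists e, [/\ dom O l1 e, le l2 e, le e u2, le l1 (fst_of O l1 e) &
                le (trd_of O l1 e) (level O)].

Definition lower_witness (le : rel nat) (O : planar) (l1 l2 u1 u2 : nat)
    : Prop :=
  left_witness le O l1 l2 u2 \/ left_witness le (transpose O) l2 l1 u1.

Definition box_inv (le : rel nat) (O : planar) (l1 l2 u1 u2 : nat) : Prop :=
  [/\ le l1 u1, le l2 u2, lower_witness le O l1 l2 u1 u2 &
      lower_witness (flip_rel le) O u1 u2 l1 l2].

(** * Symmetries: exchange of the free coordinates and order reversal *)

Lemma unsolved_transpose le O : unsolved le O -> unsolved le (transpose O).
Proof.
case=> M1 M2 M3 nu nd; split.
- by move=> x y x' y' D D' hx hy; apply: M2.
- by move=> x y x' y' D D' hx hy; apply: M1.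
- by move=> x y x' y' D D' hx hy; apply: M3.
- by move=> x y D; have := nu y x D; rewrite /up_at /= andbCA.
- by move=> x y D; have := nd y x D; rewrite /up_at /= andbCA.
Qed.

Lemma unsolved_flip le O : unsolved le O -> unsolved (flip_rel le) O.
Proof.
by case=> M1 M2 M3 nu nd; split=> // x y x' y' D D' hx hy;
  [apply: M1|apply: M2|apply: M3].
Qed.

Lemma box_inv_transpose le O l1 l2 u1 u2 :
  box_inv le O l1 l2 u1 u2 -> box_inv le (transpose O) l2 l1 u2 u1.
Proof.
(* Destructing [O] makes [transpose (transpose O)] convertible to [O]. *)
by case: O => D F1 F2 F3 c [h1 h2 [a|a] [b|b]]; split=> //; by [left|right].
Qed.

Lemma box_inv_flip le O l1 l2 u1 u2 :
  box_inv le O l1 l2 u1 u2 -> box_inv (flip_rel le) O u1 u2 l1 l2.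
Proof. by case=> h1 h2 a b; split. Qed.

(** * Cuts that preserve the invariant *)

Section Cut.
Variables (le : rel nat) (O : planar).
Hypothesis le_refl : reflexive le.
Hypothesis le_trans : transitive le.
Hypothesis le_total : total le.
Hypothesis hO : unsolved le O.

(** If [f] does not move [(m1, l2)] down in the second coordinate, [m2] is a witness on the new left
    edge. If it does, monotonicity rules out a witness on the old left edge and forces one on the
    bottom edge to lie right of [m1], where it survives. *)
Lemma lower_witness_cut l1 l2 u1 u2 m1 m2 :
  dom O l1 l2 -> dom O m1 l2 -> dom O m1 m2 ->
  le l1 m1 -> le m1 u1 -> le l2 m2 -> le m2 u2 ->
  le m1 (fst_of O m1 m2) -> le (trd_of O m1 m2) (level O) ->
  lower_witness le O l1 l2 u1 u2 -> lower_witness le O m1 l2 u1 u2.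
Proof.
case: hO => _ M2 M3 _ nd Sl Sl' Sm l1m m1u l2m m2u s1 s3 inv.
have [s2l'|s2l'] := boolP (le l2 (snd_of O m1 l2)).
  by left; split=> //; exists m2.
have F2l' : le (snd_of O m1 l2) l2.
  by case/orP: (le_total (snd_of O m1 l2) l2) s2l' => // ->.
have F3l' : le (trd_of O m1 l2) (level O).
  exact: le_trans (M3 _ _ _ _ Sl' Sm (le_refl _) l2m) s3.
case: inv => [[s2l _]|[/= s1l [e [/= Se l1e eu s2e s3e]]]].
  by case/negP: s2l'; apply: le_trans s2l (M2 _ _ _ _ Sl Sl' l1m (le_refl _)).
right; case/orP: (le_total e m1) => em.
  case/negP: s2l'.
  exact: le_trans s2e (M2 _ _ _ _ Se Sl' em (le_refl _)).
split; last by exists e.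
case/orP: (le_total m1 (fst_of O m1 l2)) => // s1l'.
by case/negP: (nd _ _ Sl'); rewrite /up_at /flip_rel s1l' F2l'.
Qed.

Lemma upper_witness_cut l1 l2 u1 u2 m1 m2 :
  dom O u1 u2 -> dom O m1 u2 -> dom O m1 m2 ->
  le m1 u1 -> le m2 u2 -> le m1 (fst_of O m1 m2) ->
  lower_witness (flip_rel le) O u1 u2 l1 l2 ->
  lower_witness (flip_rel le) O u1 u2 m1 l2.
Proof.
case: hO => M1 _ M3 nu _ Su St Sm m1u m2u s1 [H|]; first by left.
rewrite /left_witness /flip_rel /= => -[s1u [d [Sd du l1d s2d s3d]]].
right; split=> //=; case/orP: (le_total m1 d) => md; first by exists d.
have s3t := le_trans s3d (M3 _ _ _ _ Sd St md (le_refl _)).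
exists m1; split=> //.
case/orP: (le_total (snd_of O m1 u2) u2) => // s2t; case/negP: (nu _ _ St).
by rewrite /up_at s2t s3t (le_trans s1 (M1 _ _ _ _ Sm St (le_refl _) m2u)).
Qed.

(* If the lower witness does not pass to the smaller box then [(m1, l2)] is a
   solution, and if the upper one does not then [(m1, u2)] is. *)
Lemma box_inv_cut l1 l2 u1 u2 m1 m2 :
  dom O l1 l2 -> dom O u1 u2 -> dom O m1 l2 -> dom O m1 m2 -> dom O m1 u2 ->
  le l1 m1 -> le m1 u1 -> le l2 m2 -> le m2 u2 ->
  le m1 (fst_of O m1 m2) -> le (trd_of O m1 m2) (level O) ->
  box_inv le O l1 l2 u1 u2 -> box_inv le O m1 l2 u1 u2.
Proof.
move=> Sl Su Sl' Sm Su' l1m m1u l2m m2u s1 s3 [_ l2u low up]; split=> //.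
  exact: lower_witness_cut Sl Sl' Sm l1m m1u l2m m2u s1 s3 low.
exact: upper_witness_cut Su Su' Sm m1u m2u s1 up.
Qed.

End Cut.

Section Progress.
Variable O : planar.
Hypothesis hO : unsolved leq O.
Local Notation D := (dom O).
Local Notation F1 := (fst_of O).
Local Notation F2 := (snd_of O).
Local Notation F3 := (trd_of O).
Local Notation c := (level O).

Lemma box_inv_raise1 l1 l2 u1 u2 m1 m2 :
  D l1 l2 -> D u1 u2 -> D m1 l2 -> D m1 m2 -> D m1 u2 ->
  l1 <= m1 <= u1 -> l2 <= m2 <= u2 -> m1 <= F1 m1 m2 -> F3 m1 m2 <= c ->
  box_inv leq O l1 l2 u1 u2 -> box_inv leq O m1 l2 u1 u2.
Proof.
move=> Sl Su Sl' Sm Su' /andP[h1 h2] /andP[h3 h4] s1 s3.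
exact: (box_inv_cut leqnn leq_trans leq_total hO Sl Su Sl' Sm Su' h1 h2 h3 h4).
Qed.

Lemma box_inv_lower1 l1 l2 u1 u2 m1 m2 :
  D l1 l2 -> D u1 u2 -> D m1 l2 -> D m1 m2 -> D m1 u2 ->
  l1 <= m1 <= u1 -> l2 <= m2 <= u2 -> F1 m1 m2 <= m1 -> c <= F3 m1 m2 ->
  box_inv leq O l1 l2 u1 u2 -> box_inv leq O l1 l2 m1 u2.
Proof.
move=> Sl Su Sl' Sm Su' /andP[h1 h2] /andP[h3 h4] s1 s3 /box_inv_flip inv.
(* Flipping [leq] twice gives back [leq] up to conversion. *)
apply/(@box_inv_flip (flip_rel leq)).
apply: (box_inv_cut _ _ _ (unsolved_flip hO) Su Sl Su' Sm Sl') => //.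
- by move=> x; exact: leqnn.
- by move=> y x z; rewrite /flip_rel => xy zx; exact: leq_trans zx xy.
- by move=> x y; rewrite /flip_rel leq_total.
Qed.

End Progress.

Lemma box_inv_raise2 O l1 l2 u1 u2 m1 m2 : unsolved leq O ->
  dom O l1 l2 -> dom O u1 u2 -> dom O l1 m2 -> dom O m1 m2 -> dom O u1 m2 ->
  l1 <= m1 <= u1 -> l2 <= m2 <= u2 ->
  m2 <= snd_of O m1 m2 -> trd_of O m1 m2 <= level O ->
  box_inv leq O l1 l2 u1 u2 -> box_inv leq O l1 m2 u1 u2.
Proof.
case: O => D F1 F2 F3 c hO Sl Su Sl' Sm Su' h1 h2 s1 s3 /box_inv_transpose inv.
exact: (box_inv_transpose
  (box_inv_raise1 (unsolved_transpose hO) Sl Su Sl' Sm Su' h2 h1 s1 s3 inv)).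
Qed.

Lemma box_inv_lower2 O l1 l2 u1 u2 m1 m2 : unsolved leq O ->
  dom O l1 l2 -> dom O u1 u2 -> dom O l1 m2 -> dom O m1 m2 -> dom O u1 m2 ->
  l1 <= m1 <= u1 -> l2 <= m2 <= u2 ->
  snd_of O m1 m2 <= m2 -> level O <= trd_of O m1 m2 ->
  box_inv leq O l1 l2 u1 u2 -> box_inv leq O l1 l2 u1 m2.
Proof.
case: O => D F1 F2 F3 c hO Sl Su Sl' Sm Su' h1 h2 s1 s3 /box_inv_transpose inv.
exact: (box_inv_transpose
  (box_inv_lower1 (unsolved_transpose hO) Sl Su Sl' Sm Su' h2 h1 s1 s3 inv)).
Qed.

(** * Boxes with short sides *)

Definition cuts2 (O : planar) x y : bool :=
  (trd_of O x y <= level O) && (y <= snd_of O x y) ||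
  (level O <= trd_of O x y) && (snd_of O x y <= y).

(** An upper witness on the right edge must lie below [y], since there the first sign is at most 0;
    its third sign then carries up to [y]. A witness on the top edge would make the first sign at
    the upper corner at most 0, against monotonicity. *)
Lemma level_le_right_edge O l1 l2 u1 u2 y : unsolved leq O ->
  dom O u1 u2 -> dom O u1 y -> l2 <= y <= u2 ->
  box_inv leq O l1 l2 u1 u2 ->
  u1 < fst_of O u1 y -> level O <= trd_of O u1 y.
Proof.
case=> M1 _ M3 _ _ Su Sy /andP[_ yu] [_ _ _ up] s1.
case: up => -[]; rewrite /flip_rel /=.
  move=> _ [d [Sd _ _ s1d s3d]].
  apply: leq_trans s3d (M3 _ _ _ _ Sd Sy _ _) => //.
  rewrite leqNgt; apply/negP => /ltnW yd.
  by have := M1 _ _ _ _ Sy Sd (leqnn _) yd; lia.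
by move=> s1u; have := M1 _ _ _ _ Sy Su (leqnn _) yu; lia.
Qed.

Lemma left_edge_le_level O l1 l2 u1 u2 y : unsolved leq O ->
  dom O l1 l2 -> dom O l1 y -> l2 <= y <= u2 ->
  box_inv leq O l1 l2 u1 u2 ->
  fst_of O l1 y < l1 -> trd_of O l1 y <= level O.
Proof.
case=> M1 _ M3 _ _ Sl Sy /andP[ly _] [_ _ low _] s1.
case: low => -[] /=.
  move=> _ [d [Sd _ _ s1d s3d]].
  apply: leq_trans (M3 _ _ _ _ Sy Sd _ _) s3d => //.
  rewrite leqNgt; apply/negP => /ltnW yd.
  by have := M1 _ _ _ _ Sd Sy (leqnn _) yd; lia.
by move=> s1u; have := M1 _ _ _ _ Sl Sy (leqnn _) ly; lia.
Qed.

(* If neither end of a row of width at most 2 allows a cut, then [f] moves both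
   ends strictly towards the other one, against monotonicity. *)
Lemma strip_cuts2 O l1 l2 u1 u2 y : unsolved leq O ->
  dom O l1 l2 -> dom O u1 u2 -> dom O l1 y -> dom O u1 y ->
  u1 <= l1.+1 -> l2 <= y <= u2 ->
  box_inv leq O l1 l2 u1 u2 -> cuts2 O u1 y || cuts2 O l1 y.
Proof.
move=> hO Sl Su Sp Sq g hy inv.
have rq := level_le_right_edge hO Su Sq hy inv.
have rp := left_edge_le_level hO Sl Sp hy inv.
case: hO inv => M1 _ _ nu nd [l1u _ _ _].
have := M1 _ _ _ _ Sp Sq l1u (leqnn _).
have := nu _ _ Sp; have := nd _ _ Sp; have := nu _ _ Sq; have := nd _ _ Sq.
by rewrite /up_at /flip_rel /cuts2; lia.
Qed.

(** With height at most 1, every witness point is an end of the column, so the invariant reduces to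
    signs at two points. *)
Lemma final_column O l1 l2 u2 : unsolved leq O -> u2 <= l2.+1 ->
  dom O l1 l2 -> dom O l1 u2 -> box_inv leq O l1 l2 l1 u2 -> False.
Proof.
case: O => D F1 F2 F3 c [/= M1 M2 M3 nu nd] g Sl Su [_ l2u low up].
have A1 := M1 _ _ _ _ Sl Su (leqnn _) l2u.
have A2 := M2 _ _ _ _ Sl Su (leqnn _) l2u.
have A3 := M3 _ _ _ _ Sl Su (leqnn _) l2u.
move: (nu _ _ Sl) (nu _ _ Su) (nd _ _ Sl) (nd _ _ Su).
rewrite /up_at /flip_rel /= => nul nuu ndl ndu.
have {}low : [&& l1 <= F1 l1 l2, F3 l1 l2 <= c & l2 <= F2 l1 l2] ||
             [&& l1 <= F1 l1 u2, F3 l1 u2 <= c & l2 <= F2 l1 l2].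
  case: low => -[/= s2 [e [/= _ e1 e2 s1 s3]]].
    by have [ee|ee] : e = l2 \/ e = u2 by [lia]; subst e; lia.
  by have ee : e = l1 by [lia]; subst e; lia.
have {}up : [&& F1 l1 u2 <= l1, c <= F3 l1 u2 & F2 l1 u2 <= u2] ||
            [&& F1 l1 l2 <= l1, c <= F3 l1 l2 & F2 l1 u2 <= u2].
  case: up; rewrite /left_witness /flip_rel /= => -[s2 [e [_ e1 e2 s1 s3]]].
    by have [ee|ee] : e = l2 \/ e = u2 by [lia]; subst e; lia.
  by have ee : e = l1 by [lia]; subst e; lia.
clear M1 M2 M3 nu nd.
by case/orP: low => /and3P[? ? ?]; case/orP: up => /and3P[? ? ?]; lia.
Qed.

Lemma final_row O l1 l2 u1 : unsolved leq O ->
  u1 <= l1.+1 -> dom O l1 l2 -> dom O u1 l2 -> box_inv leq O l1 l2 u1 l2 ->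
  False.
Proof.
move=> hO g Sl Su /box_inv_transpose inv.
exact: final_column (unsolved_transpose hO) g Sl Su inv.
Qed.

(** A cut at [(u1, l2)] or [(l1, u2)] collapses the box to one row or column. Without such a cut,
    [f] moves these two corners strictly inwards in both coordinates, hence, the sides being at most
    1, as far as the opposite side. *)
Lemma final_box O l1 l2 u1 u2 : unsolved leq O ->
  u1 <= l1.+1 -> u2 <= l2.+1 ->
  dom O l1 l2 -> dom O u1 l2 -> dom O l1 u2 -> dom O u1 u2 ->
  box_inv leq O l1 l2 u1 u2 -> False.
Proof.
move=> hO g1 g2 Sll Sul Slu Suu inv; have [h1 h2 _ _] := inv.
have e1 : l1 <= l1 <= u1 by rewrite leqnn.
have e1' : l1 <= u1 <= u1 by rewrite leqnn andbT.
have e2 : l2 <= l2 <= u2 by rewrite leqnn.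
have e2' : l2 <= u2 <= u2 by rewrite leqnn andbT.
have [|nr1] := boolP ((trd_of O u1 l2 <= level O) && (u1 <= fst_of O u1 l2)).
  case/andP=> s3 s1; apply: (final_column hO g2 Sul Suu).
  exact: (box_inv_raise1 hO Sll Suu Sul Sul Suu e1' e2 s1 s3 inv).
have [|nl2] := boolP ((level O <= trd_of O u1 l2) && (snd_of O u1 l2 <= l2)).
  case/andP=> s3 s1; apply: (final_row hO g1 Sll Sul).
  exact: (box_inv_lower2 hO Sll Suu Sll Sul Sul e1' e2 s1 s3 inv).
have [|nr2] := boolP ((trd_of O l1 u2 <= level O) && (u2 <= snd_of O l1 u2)).
  case/andP=> s3 s1; apply: (final_row hO g1 Slu Suu).
  exact: (box_inv_raise2 hO Sll Suu Slu Slu Suu e1 e2' s1 s3 inv).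
have [|nl1] := boolP ((level O <= trd_of O l1 u2) && (fst_of O l1 u2 <= l1)).
  case/andP=> s3 s1; apply: (final_column hO g2 Sll Slu).
  exact: (box_inv_lower1 hO Sll Suu Sll Slu Slu e1 e2' s1 s3 inv).
have [M1 M2 M3 nu nd] := hO.
have {nr1 nl2} [a1 a2] : fst_of O u1 l2 < u1 /\ l2 < snd_of O u1 l2.
  by have := nu _ _ Sul; have := nd _ _ Sul; rewrite /up_at /flip_rel; lia.
have {nr2 nl1} [b1 b2] : l1 < fst_of O l1 u2 /\ snd_of O l1 u2 < u2.
  by have := nu _ _ Slu; have := nd _ _ Slu; rewrite /up_at /flip_rel; lia.
(* The upper corner is now an up point and the lower one a down point for the
   two free coordinates, so their third coordinates are in the wrong order. *)
have := M1 _ _ _ _ Sll Sul h1 (leqnn _).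
have := M1 _ _ _ _ Slu Suu h1 (leqnn _).
have := M2 _ _ _ _ Sll Slu (leqnn _) h2.
have := M2 _ _ _ _ Sul Suu (leqnn _) h2.
have := M3 _ _ _ _ Sll Suu h1 h2.
by have := nu _ _ Suu; have := nd _ _ Sll; rewrite /up_at /flip_rel; lia.
Qed.

(** * The shrinking step and its progress *)

(* [(l1, l2, u1, u2)]: lower corner [(l1, l2)], upper corner [(u1, u2)]. *)
Definition box : Type := (nat * nat * nat * nat)%type.

Definition mid (l u : nat) : nat := (l + u)./2.

Definition mid_row (B : box) : seq (nat * nat) :=
  let: (l1, l2, u1, u2) := B in
  [:: (l1, mid l2 u2); (mid l1 u1, mid l2 u2); (u1, mid l2 u2)].

Definition mid_col (B : box) : seq (nat * nat) :=
  let: (l1, l2, u1, u2) := B in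
  [:: (mid l1 u1, l2); (mid l1 u1, mid l2 u2); (mid l1 u1, u2)].

Definition corners (B : box) : seq (nat * nat) :=
  let: (l1, l2, u1, u2) := B in [:: (l1, l2); (u1, l2); (l1, u2); (u1, u2)].

Definition grid B := mid_row B ++ mid_col B ++ corners B.

(* [v] pairs a free coordinate of [f] with the fixed one. *)
Definition raises (c m : nat) (v : nat * nat) : bool :=
  (v.2 <= c) && (m <= v.1).
Definition lowers (c m : nat) (v : nat * nat) : bool :=
  (c <= v.2) && (v.1 <= m).

(** Takes answers as lists, so that the query tree can apply it to what it has read. Sides of length
    at most 1 are left alone, as their middle is their lower end. *)
Definition shrink (c : nat) (B : box) (row col : seq (nat * nat)) : box :=
  let: (l1, l2, u1, u2) := B in
  let m1 := mid l1 u1 in let m2 := mid l2 u2 in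
  if (l2.+1 < u2) && has (raises c m2) row then (l1, m2, u1, u2)
  else if (l2.+1 < u2) && has (lowers c m2) row then (l1, l2, u1, m2)
  else if (l1.+1 < u1) && has (raises c m1) col then (m1, l2, u1, u2)
  else if (l1.+1 < u1) && has (lowers c m1) col then (l1, l2, m1, u2)
  else B.

Definition shrink_by (O : planar) (B : box) : box :=
  shrink (level O) B
    [seq (snd_of O p.1 p.2, trd_of O p.1 p.2) | p <- mid_row B]
    [seq (fst_of O p.1 p.2, trd_of O p.1 p.2) | p <- mid_col B].

Fixpoint visited (O : planar) (N : nat) (B : box) : seq (nat * nat) :=
  if N is N'.+1 then grid B ++ visited O N' (shrink_by O B) else [::].

Definition box_ok (O : planar) (B : box) : Prop :=
  let: (l1, l2, u1, u2) := B in box_inv leq O l1 l2 u1 u2.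

Definition box_gaps (B : box) (g1 g2 : nat) : Prop :=
  let: (l1, l2, u1, u2) := B in u1 <= l1 + g1 /\ u2 <= l2 + g2.

(** The measure is the sum of the exponents of powers of 2 bounding the sides; halving a side lowers
    its exponent by one. *)
Lemma shrink_progress O l1 l2 u1 u2 : unsolved leq O ->
  box_inv leq O l1 l2 u1 u2 ->
  (forall p, p \in grid (l1, l2, u1, u2) -> dom O p.1 p.2) ->
  box_ok O (shrink_by O (l1, l2, u1, u2)) /\
  (forall i j, u1 <= l1 + 2 ^ i -> u2 <= l2 + 2 ^ j ->
    exists i' j', i' + j' < i + j /\
      box_gaps (shrink_by O (l1, l2, u1, u2)) (2 ^ i') (2 ^ j')).
Proof.
move=> hO inv hD; have [h1 h2 _ _] := inv.
set m1 := mid l1 u1; set m2 := mid l2 u2.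
have dm (x y : nat) : (x, y) \in grid (l1, l2, u1, u2) -> dom O x y by move/hD.
have D00 : dom O l1 l2 by apply: dm; rewrite !inE eqxx ?orbT.
have D01 : dom O l1 m2 by apply: dm; rewrite !inE eqxx ?orbT.
have D02 : dom O l1 u2 by apply: dm; rewrite !inE eqxx ?orbT.
have D10 : dom O m1 l2 by apply: dm; rewrite !inE eqxx ?orbT.
have D11 : dom O m1 m2 by apply: dm; rewrite !inE eqxx ?orbT.
have D12 : dom O m1 u2 by apply: dm; rewrite !inE eqxx ?orbT.
have D20 : dom O u1 l2 by apply: dm; rewrite !inE eqxx ?orbT.
have D21 : dom O u1 m2 by apply: dm; rewrite !inE eqxx ?orbT.
have D22 : dom O u1 u2 by apply: dm; rewrite !inE eqxx ?orbT.
have [big|] := boolP ((l1.+1 < u1) || (l2.+1 < u2)); last first.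
  rewrite negb_or -!leqNgt => /andP[g1 g2].
  by case: (final_box hO g1 g2 D00 D20 D02 D22 inv).
have hm1 : l1 <= m1 <= u1 by rewrite /m1 /mid; lia.
have hm2 : l2 <= m2 <= u2 by rewrite /m2 /mid; lia.
have dec2 i j : l2.+1 < u2 -> u2 <= l2 + 2 ^ j ->
    exists j', [/\ i + j' < i + j, u2 <= m2 + 2 ^ j' & m2 <= l2 + 2 ^ j'].
  case: j => [|j]; first lia.
  by rewrite expnS => g hj; exists j; rewrite /m2 /mid; split; lia.
have dec1 i j : l1.+1 < u1 -> u1 <= l1 + 2 ^ i ->
    exists i', [/\ i' + j < i + j, u1 <= m1 + 2 ^ i' & m1 <= l1 + 2 ^ i'].
  case: i => [|i]; first lia.
  by rewrite expnS => g hj; exists i; rewrite /m1 /mid; split; lia.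
rewrite /shrink_by /shrink -/m1 -/m2.
case: ifP => [/andP[g2 /hasP[v /mapP[p hp ->] /andP[/= s3 s2]]]|n1].
  have [hp1 hp2 Dp] : [/\ l1 <= p.1 <= u1, p.2 = m2 & dom O p.1 p.2].
    by move: hp; rewrite !inE => /or3P[] /eqP-> /=; rewrite ?leqnn ?h1.
  rewrite hp2 in Dp s3 s2; split=> //.
    exact: (box_inv_raise2 hO D00 D22 D01 Dp D21 hp1 hm2 s2 s3 inv).
  by move=> i j hi hj; have [j' []] := dec2 i j g2 hj; exists i, j'.
case: ifP => [/andP[g2 /hasP[v /mapP[p hp ->] /andP[/= s3 s2]]]|n2].
  have [hp1 hp2 Dp] : [/\ l1 <= p.1 <= u1, p.2 = m2 & dom O p.1 p.2].
    by move: hp; rewrite !inE => /or3P[] /eqP-> /=; rewrite ?leqnn ?h1.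
  rewrite hp2 in Dp s3 s2; split=> //.
    exact: (box_inv_lower2 hO D00 D22 D01 Dp D21 hp1 hm2 s2 s3 inv).
  by move=> i j hi hj; have [j' []] := dec2 i j g2 hj; exists i, j'.
case: ifP => [/andP[g2 /hasP[v /mapP[p hp ->] /andP[/= s3 s2]]]|n3].
  have [hp1 hp2 Dp] : [/\ l2 <= p.2 <= u2, p.1 = m1 & dom O p.1 p.2].
    by move: hp; rewrite !inE => /or3P[] /eqP-> /=; rewrite ?leqnn ?h2.
  rewrite hp2 in Dp s3 s2; split=> //.
    exact: (box_inv_raise1 hO D00 D22 D10 Dp D12 hm1 hp1 s2 s3 inv).
  by move=> i j hi hj; have [j' []] := dec1 i j g2 hi; exists j', j.
case: ifP => [/andP[g2 /hasP[v /mapP[p hp ->] /andP[/= s3 s2]]]|n4].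
  have [hp1 hp2 Dp] : [/\ l2 <= p.2 <= u2, p.1 = m1 & dom O p.1 p.2].
    by move: hp; rewrite !inE => /or3P[] /eqP-> /=; rewrite ?leqnn ?h2.
  rewrite hp2 in Dp s3 s2; split=> //.
    exact: (box_inv_lower1 hO D00 D22 D10 Dp D12 hm1 hp1 s2 s3 inv).
  by move=> i j hi hj; have [j' []] := dec1 i j g2 hi; exists j', j.
exfalso.
(* With two long sides the centre alone gives a cut, not being a solution. With one long side,
   [strip_cuts2] finds a cut on the middle line across it. *)
have [g1|g1] := ltnP l1.+1 u1; have [g2|g2] := ltnP l2.+1 u2.
- case: hO => _ _ _ nu nd; have := nu _ _ D11; have := nd _ _ D11.
  move: n1 n2 n3 n4; rewrite g1 g2 /= /raises /lowers /= -/m1 -/m2.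
  by rewrite /up_at /flip_rel; lia.
- move: n3 n4; rewrite g1 /= /raises /lowers /= -/m1 -/m2.
  have := strip_cuts2 (unsolved_transpose hO) D00 D22 D10 D12 g2 hm1
    (box_inv_transpose inv).
  by rewrite /cuts2 /=; lia.
- move: n1 n2; rewrite g2 /= /raises /lowers /= -/m1 -/m2.
  have := strip_cuts2 hO D00 D22 D01 D21 g1 hm2 inv.
  by rewrite /cuts2 /=; lia.
- lia.
Qed.

(** Each round lowers [i + j], so from [i + j <= N] there is no room for [N.+1] rounds. *)
Lemma unsolved_search_absurd O N i j l1 l2 u1 u2 : unsolved leq O ->
  i + j <= N -> u1 <= l1 + 2 ^ i -> u2 <= l2 + 2 ^ j ->
  box_inv leq O l1 l2 u1 u2 ->
  (forall p, p \in visited O N.+1 (l1, l2, u1, u2) -> dom O p.1 p.2) -> False.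
Proof.
move=> hO; elim: N i j l1 l2 u1 u2 => [|N IH] i j l1 l2 u1 u2 hN hi hj inv hD.
  have hG p : p \in grid (l1, l2, u1, u2) -> dom O p.1 p.2.
    by move=> hp; apply: hD; rewrite /visited mem_cat hp.
  have [_ /(_ i j hi hj)[i' [j' [lt _]]]] := shrink_progress hO inv hG; lia.
have hG p : p \in grid (l1, l2, u1, u2) -> dom O p.1 p.2.
  by move=> hp; apply: hD; rewrite mem_cat hp.
have [ok /(_ i j hi hj)[i' [j' [lt gaps]]]] := shrink_progress hO inv hG.
have {}hD p : p \in visited O N.+1 (shrink_by O (l1, l2, u1, u2)) ->
    dom O p.1 p.2.
  by move=> hp; apply: hD; rewrite mem_cat hp orbT.
case: (shrink_by O _) ok gaps hD => [[[l1' l2'] u1'] u2'] ok [gi gj] hD.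
by apply: (IH i' j' l1' l2' u1' u2') => //; lia.
Qed.

Lemma visited_in_box O N l1 l2 u1 u2 p : l1 <= u1 -> l2 <= u2 ->
  p \in visited O N (l1, l2, u1, u2) -> (l1 <= p.1 <= u1) && (l2 <= p.2 <= u2).
Proof.
elim: N l1 l2 u1 u2 => [//|N IH] l1 l2 u1 u2 h1 h2.
have hm1 : l1 <= mid l1 u1 <= u1 by rewrite /mid; lia.
have hm2 : l2 <= mid l2 u2 <= u2 by rewrite /mid; lia.
rewrite mem_cat => /orP[|].
  by rewrite !inE; do !case/orP; move/eqP->; rewrite /= ?leqnn ?hm1 ?hm2 ?h1 ?h2.
rewrite /shrink_by /shrink.
do 4! (case: ifP => _;
  first by move=> hp; have := IH _ _ _ _ _ _ hp; lia).
exact: IH.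
Qed.

(** * Batches of queries and lattice points built from coordinates *)

Fixpoint query_seq (Q A O : Type) (qs : seq Q)
    (k : seq A -> query_tree Q A O) : query_tree Q A O :=
  if qs is q :: qs' then
    Query q (fun v => query_seq qs' (fun vs => k (v :: vs)))
  else k [::].

Lemma run_query_seq (Q A O : Type) (f : Q -> A) qs
    (k : seq A -> query_tree Q A O) :
  run f (query_seq qs k) = run f (k (map f qs)).
Proof. by elim: qs k => //= q qs IH k; rewrite IH. Qed.

Lemma num_query_seq (Q A O : Type) (f : Q -> A) qs
    (k : seq A -> query_tree Q A O) :
  num_queries f (query_seq qs k) = size qs + num_queries f (k (map f qs)).
Proof. by elim: qs k => //= q qs IH k; rewrite IH addSn. Qed.

Lemma coordP (k : nat) (n : 'I_k -> nat) (x : lattice n) i :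
  0 < coord x i <= n i.
Proof. by case: x => x hx; apply: (forallP hx). Qed.

Lemma clamp_proof (k : nat) (n : 'I_k -> nat) (a b : lattice n)
    (w : 'I_k -> nat) :
  [forall i, 0 < [ffun i => minn (coord b i) (maxn (coord a i) (w i))] i <= n i].
Proof.
apply/forallP => i; rewrite ffunE.
by have := coordP a i; have := coordP b i; lia.
Qed.

(** Makes every tuple of naturals a legal query; values already between [a] and [b] are
    unchanged. *)
Definition clamp (k : nat) (n : 'I_k -> nat) (a b : lattice n) (w : 'I_k -> nat)
    : lattice n :=
  exist (fun x : {ffun 'I_k -> nat} => is_true [forall i, 0 < x i <= n i])
    _ (clamp_proof a b w).

Lemma coord_clamp (k : nat) (n : 'I_k -> nat) (a b : lattice n) w i :
  coord (clamp a b w) i = minn (coord b i) (maxn (coord a i) (w i)).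
Proof. by rewrite /coord /= ffunE. Qed.

Lemma preceq_clamp (k : nat) (n : 'I_k -> nat) (a b : lattice n) w w' :
  (forall i, w i <= w' i) -> preceq (clamp a b w) (clamp a b w').
Proof.
by move=> h; apply/forallP => i; rewrite !coord_clamp; have := h i; lia.
Qed.

Lemma sub_instance_clamp (k : nat) (n : 'I_k -> nat) (a b : lattice n) w :
  preceq a b -> sub_instance a b (clamp a b w).
Proof.
move/forallP => ab; apply/andP; split; apply/forallP => i; rewrite coord_clamp;
  by have := ab i; lia.
Qed.

(** Cyclic successors name the two free coordinates uniformly in the fixed one. *)
Lemma ord3P (i0 i : 'I_3) : [\/ i = i0, i = ordS i0 | i = ordS (ordS i0)].
Proof.
case: i0 => [[|[|[|?]]] ?] //; case: i => [[|[|[|?]]] ?] //;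
 by [apply: Or31; apply: val_inj|apply: Or32; apply: val_inj
     |apply: Or33; apply: val_inj].
Qed.

Lemma ordS3_neq (i : 'I_3) :
  (ordS i == i = false) * (ordS (ordS i) == i = false) *
  (ordS (ordS i) == ordS i = false).
Proof. by case: i => [[|[|[|?]]] ?]. Qed.

(** * The search tree and its query count *)

Section Search.
Variables (n : 'I_3 -> nat) (a b : lattice n) (s : slice 3).

Definition fixed_index : 'I_3 := odflt ord0 [pick i | isSome (s i)].
Local Notation i0 := fixed_index.
Local Notation i1 := (ordS i0).
Local Notation i2 := (ordS i1).
Definition fixed_value : nat := odflt 0 (s i0).

Definition slice_point (p : nat * nat) : lattice n :=
  clamp a b (fun i =>
    if i == i0 then fixed_value else if i == i1 then p.1 else p.2).

Definition start : box := (coord a i1, coord a i2, coord b i1, coord b i2).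

(* Queried points with their answers. *)
Definition history := seq (lattice n * lattice n).

Definition violations (h : history)
    : seq ((lattice n * lattice n) * (lattice n * lattice n)) :=
  [seq r <- [seq (p, q) | p <- h, q <- h]
     | preceq r.1.1 r.2.1 && ~~ preceq r.1.2 r.2.2].

Definition solutions (h : history) : history :=
  [seq p <- h | preceq p.1 p.2 || preceq p.2 p.1].

(* [h] records the queries outside the slice (the two corners [a] and [b]),
   [hs] those inside it; the last [Point a] is never reached. *)
Definition verdict (h hs : history) : inner_output n :=
  if violations (h ++ hs) is r :: _ then Pair r.1.1 r.2.1
  else if solutions hs is p :: _ then Point p.1 else Point a.

Fixpoint explore (N : nat) (B : box) (h hs : history)
    : query_tree (lattice n) (lattice n) (inner_output n) :=
  if N is N'.+1 then
    query_seq (map slice_point (mid_row B)) (fun row =>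
    query_seq (map slice_point (mid_col B)) (fun col =>
    query_seq (map slice_point (corners B)) (fun cor =>
    explore N'
      (shrink fixed_value B [seq (coord v i2, coord v i0) | v <- row]
                            [seq (coord v i1, coord v i0) | v <- col])
      h (hs ++ zip (map slice_point (grid B)) (row ++ col ++ cor)))))
  else Output _ _ (verdict h hs).

(** Both sides start below 2 to the power [(trunc_log 2 (width n)).+1]; one further round gives the
    contradiction. *)
Definition rounds : nat := (2 * (trunc_log 2 (width n)).+1).+1.

Definition search : query_tree (lattice n) (lattice n) (inner_output n) :=
  query_seq [:: a; b] (fun vs => explore rounds start (zip [:: a; b] vs) [::]).

Variable f : lattice n -> lattice n.

Definition slice_planar (D : nat -> nat -> Prop) : planar :=
  Planar D (fun x y => coord (f (slice_point (x, y))) i1)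
    (fun x y => coord (f (slice_point (x, y))) i2)
    (fun x y => coord (f (slice_point (x, y))) i0) fixed_value.

(** Avoids a circularity: [dom] is to be the set of visited points, which is itself computed from
    the planar problem. *)
Lemma visited_slice_planar D D' N B :
  visited (slice_planar D) N B = visited (slice_planar D') N B.
Proof. by elim: N B => //= N IH B; rewrite IH. Qed.

Definition record (p : lattice n) := (p, f p).

Lemma run_explore D N B h hs :
  run f (explore N B h hs) =
  verdict h
    (hs ++ [seq record (slice_point p) | p <- visited (slice_planar D) N B]).
Proof.
elim: N B hs => [|N IH] B hs; first by rewrite cats0.
rewrite [LHS]/= !run_query_seq IH /= map_cat -catA -!map_comp.
congr (verdict _ (_ ++ _ ++ _)).
by rewrite /grid -!map_cat; elim: (_ ++ _) => //= p r ->.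
Qed.

(** Three points on each middle line, the centre being asked twice, and four corners. *)
Lemma num_queries_explore N B h hs : num_queries f (explore N B h hs) = 10 * N.
Proof.
elim: N B hs => [|N IH] B hs //=.
rewrite !num_query_seq IH !size_map.
by case: B => [[[? ?] ?] ?] /=; rewrite mulnS.
Qed.

Lemma num_queries_search : num_queries f search = 10 * rounds + 2.
Proof. by rewrite /search num_query_seq num_queries_explore addnC. Qed.

Lemma record_violations (ps : seq (lattice n)) r :
  r \in violations (map record ps) ->
  exists x y, [/\ x \in ps, y \in ps, violation f x y & r = (record x, record y)].
Proof.
rewrite mem_filter => /andP[hv /allpairsP[[p q] /= [hp hq er]]].
case/mapP: hp er => x hx ->; case/mapP: hq => y hy -> er.
by exists x, y; split=> //; move: hv; rewrite er.
Qed.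

(** * Correctness of the search *)

Hypothesis hin : inner_input f a b s.

Lemma fixed_indexP : s i0 = Some fixed_value.
Proof.
case: hin => _ _ _ [i [hi _]] _; rewrite /fixed_value /i0.
case: pickP => [j|/(_ i)] /=.
  by case: (s j).
by case: (s i) hi.
Qed.

Lemma free_index i : i != i0 -> s i = None.
Proof.
case: hin => _ _ _ [j [_ hj]] _ hi; case E: (s i) => [c|] //.
have ji : j = i by apply: hj; rewrite E.
have j0 : j = i0 by apply: hj; rewrite fixed_indexP.
by rewrite -ji j0 eqxx in hi.
Qed.

Lemma fixed_value_bounds : coord a i0 <= fixed_value <= coord b i0.
Proof. by case: hin => _ _ _ _ h; apply: h; apply: fixed_indexP. Qed.

Lemma start_le i : coord a i <= coord b i.
Proof. by case: hin => _ /forallP h *. Qed.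

Lemma coord_slice_point0 p : coord (slice_point p) i0 = fixed_value.
Proof. by rewrite coord_clamp eqxx; have := fixed_value_bounds; lia. Qed.

Lemma coord_slice_point1 p : coord a i1 <= p.1 <= coord b i1 ->
  coord (slice_point p) i1 = p.1.
Proof. by move=> h; rewrite coord_clamp ordS3_neq eqxx; lia. Qed.

Lemma coord_slice_point2 p : coord a i2 <= p.2 <= coord b i2 ->
  coord (slice_point p) i2 = p.2.
Proof. by move=> h; rewrite coord_clamp !ordS3_neq; lia. Qed.

Lemma slice_point_in p : in_slice s (slice_point p).
Proof.
move=> i c hi; have [e|/free_index] := eqVneq i i0; last by rewrite hi.
by move: hi; rewrite e fixed_indexP coord_slice_point0 => -[].
Qed.

Lemma trunc_log_width i : coord b i <= 2 ^ (trunc_log 2 (width n)).+1.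
Proof.
have /andP[_ bn] := coordP b i; apply: leq_trans bn _.
apply: leq_trans (leq_bigmax i) _.
exact/ltnW/trunc_log_ltn.
Qed.

(** A reported pair or point is correct by construction. If nothing is found, the planar problem on
    the visited points is [unsolved], which [unsolved_search_absurd] excludes. *)
Lemma search_correct : correct_output f a b s (run f search).
Proof.
pose N := rounds; pose O0 := slice_planar (fun _ _ => True).
pose vis := visited O0 N start.
have -> : run f search =
    verdict (map record [:: a; b]) [seq record (slice_point p) | p <- vis].
  by rewrite /search run_query_seq (run_explore (fun _ _ => True)).
have ab : preceq a b by case: hin.
have in_box p : p \in vis ->
    (coord a i1 <= p.1 <= coord b i1) && (coord a i2 <= p.2 <= coord b i2).
  exact/visited_in_box/start_le/start_le.
pose ps := [:: a; b] ++ map slice_point vis.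
have sub x : x \in ps -> sub_instance a b x.
  rewrite mem_cat => /orP[|/mapP[p _ ->]]; last exact: sub_instance_clamp.
  have refl (z : lattice n) : preceq z z by apply/forallP.
  by rewrite !inE => /orP[] /eqP->; rewrite /sub_instance refl ab.
rewrite /verdict map_comp -map_cat -/ps.
case Ev : (violations _) => [|r rs]; last first.
  have : r \in violations (map record ps) by rewrite Ev mem_head.
  case/record_violations => x [y [hx hy hv ->]] /=.
  by split; [exact: sub|exact: sub|].
case Es : (solutions _) => [|q qs]; last first.
  have : q \in solutions (map record (map slice_point vis)) by rewrite Es mem_head.
  rewrite mem_filter => /andP[ud /mapP[x /mapP[p hp ->] eq]].
  rewrite eq /= in ud *; split; last exact/orP.
    exact: sub_instance_clamp.
  exact: slice_point_in.
exfalso.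
have mono x y : x \in ps -> y \in ps -> preceq x y -> preceq (f x) (f y).
  move=> hx hy xy; apply/negPn/negP => nxy.
  have : (record x, record y) \in violations (map record ps).
    by rewrite mem_filter xy nxy; apply: (allpairs_f pair); apply: map_f.
  by rewrite Ev.
have nosol p : p \in vis -> ~~ (Up f (slice_point p) || Down f (slice_point p)).
  move=> hp; apply/negP => hs.
  have : record (slice_point p) \in solutions (map record (map slice_point vis)).
    by rewrite mem_filter hs !map_f.
  by rewrite Es.
pose O := slice_planar (fun x y => (x, y) \in vis).
have in_ps p : p \in vis -> slice_point p \in ps.
  by move=> hp; rewrite mem_cat map_f ?orbT.
have monoO i :
    monotone_on leq (dom O) (fun x y => coord (f (slice_point (x, y))) i).
  move=> x y x' y' hp hq xx yy.
  have /forallP h : preceq (f (slice_point (x, y))) (f (slice_point (x', y'))).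
    apply: mono (in_ps _ hp) (in_ps _ hq) (preceq_clamp _ _ _) => j.
    by case: ifP => // _; case: ifP.
  exact: h.
have hO : unsolved leq O.
  split; [exact: (monoO i1)|exact: (monoO i2)|exact: (monoO i0)| |].
    move=> x y hp; apply: contra (nosol _ hp) => /and3P[/= s1 s2 s3].
    have /andP[c1 c2] := in_box _ hp; apply/orP; left; apply/forallP => i.
    by case: (ord3P i0 i) => ->;
    rewrite ?coord_slice_point0 ?coord_slice_point1 ?coord_slice_point2.
  move=> x y hp; apply: contra (nosol _ hp) => /and3P[/= s1 s2 s3].
  have /andP[c1 c2] := in_box _ hp; apply/orP; right; apply/forallP => i.
  by case: (ord3P i0 i) => ->;
    rewrite ?coord_slice_point0 ?coord_slice_point1 ?coord_slice_point2.
have visE : visited O N start = vis by apply: visited_slice_planar.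
have la : (coord a i1, coord a i2) \in vis.
  by rewrite /vis /N /rounds mem_cat !inE eqxx !orbT.
have lb : (coord b i1, coord b i2) \in vis.
  by rewrite /vis /N /rounds mem_cat !inE eqxx !orbT.
have [ua db] : Up f a /\ Down f b by case: hin.
(* This is why [a] and [b] are queried: [a] is an up point below the lower corner of the slice, so
   monotonicity bounds [f] at that corner from below by [a]. Dually for [b]. *)
have ale i : coord a i <= coord (f (slice_point (coord a i1, coord a i2))) i.
  have /andP[/(mono _ _ (mem_head _ _) (in_ps _ la))/forallP h _] := sub _ (in_ps _ la).
  exact: leq_trans (forallP ua i) (h i).
have ble i : coord (f (slice_point (coord b i1, coord b i2))) i <= coord b i.
  have hb : b \in ps by rewrite !inE eqxx orbT.
  have /andP[_ /(mono _ _ (in_ps _ lb) hb)/forallP h] := sub _ (in_ps _ lb).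
  exact: leq_trans (h i) (forallP db i).
have gap i : coord b i <= coord a i + 2 ^ (trunc_log 2 (width n)).+1.
  exact: leq_trans (trunc_log_width i) (leq_addl _ _).
apply: (@unsolved_search_absurd O N.-1 _ _ _ _ _ _ hO _ (gap i1) (gap i2)).
- by rewrite addnn -mul2n.
(* Each corner serves as its own witness; its third sign is the required one, since otherwise the
   corner would be a solution. *)
- split; rewrite ?start_le //; left; split=> //=.
    exists (coord a i2); split=> //=; first exact: start_le.
    have [_ _ _ nu _] := hO; have := nu _ _ la; rewrite /up_at /= !ale /=.
    by rewrite -ltnNge => /ltnW.
    exact: ble.
  exists (coord b i2); split=> //=; rewrite /flip_rel ?ble //.
    exact: start_le.
  have [_ _ _ _ nd] := hO; have := nd _ _ lb; rewrite /up_at /flip_rel /= !ble /=.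
  by rewrite -ltnNge => /ltnW.
- by move=> -[x y]; rewrite visE.
Qed.

End Search.

(* [trunc_log 2 m] is the floor of log_2 m; it is at least 1 for m >= 2. *)
Theorem theorem14 :
  exists alg : slice_algorithm 3,
    inner_algorithm alg /\
    exists C : nat,
      forall (n : 'I_3 -> nat) (f : lattice n -> lattice n) (a b : lattice n)
        (s : slice 3),
        inner_input f a b s -> 2 <= width n ->
        num_queries f (alg n a b s) <= C * trunc_log 2 (width n).
Proof.
exists (fun n a b s => search a b s); split.
  by move=> n f a b s; exact: search_correct.
(* With [t] the logarithm, the count is [10 * (2 * t + 3) + 2 = 20 * t + 32], at most [52 * t] as
   [t >= 1]. *)
exists 52 => n f a b s _ w2; rewrite num_queries_search /rounds.
have : 0 < trunc_log 2 (width n) by rewrite trunc_log_gt0.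
lia.
Qed.
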